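(* For every $\epsilon\in(0,\frac12)$ the following holds. Let $H$ be a finite-dimensional real inner product space, $\mathcal T$ a compact convex set of self-adjoint operators on $H$, and $Q$ a density operator on $H$. Then there exist a number $k\le C(1+S(Q\,\|\,\mathcal U))\frac{\Delta(\mathcal T)}{\epsilon}$ ($C>0$ a universal constant), a univariate polynomial $p$ of degree $k$, and an element $F\in\mathcal T$ such that $\mathrm{Tr}(p(F)^2)=1$ and $[Q-p(F)^2]_{\mathcal T}\le\epsilon$.
   Context: $\Delta(\mathcal T)=\sup_{A\in\mathcal T}\|A\|$ (operator norm). For a self-adjoint $A$, $[A]_{\mathcal T}=\sup_{B\in\mathcal T}\mathrm{Tr}(BA)$. A density operator is psd self-adjoint of trace one; $\mathcal U=\mathrm{Id}/\mathrm{Tr}(\mathrm{Id})$; $S(X\,\|\,Y)=\mathrm{Tr}(X(\log X-\log Y))$. *)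

(* Defs.v *)
From HB Require Import structures.
From mathcomp Require Import all_boot all_order all_algebra.
From mathcomp Require Import all_classical all_reals all_analysis.

Set Implicit Arguments.
Unset Strict Implicit.
Unset Printing Implicit Defensive.

Import Order.TTheory GRing.Theory Num.Theory.
Import numFieldNormedType.Exports.

Local Open Scope classical_set_scope.
Local Open Scope ring_scope.

(* A finite-dimensional real inner product space is a pair of H : vectType R
   and ip : {dot H for idfun}, a symmetric positive definite bilinear form. *)

Definition lfmx (R : realType) (H : vectType R) (A : 'End(H)) :
    'M[R]_(\dim {:H}) :=
  passmx.mxof (vbasis {:H}) (vbasis {:H}) A.

Definition lftrace (R : realType) (H : vectType R) (A : 'End(H)) : R :=
  \tr (lfmx A).

(* 'End(H) with its Hausdorff vector space topology, which is unique in finite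
   dimension and is obtained here from the matrix coordinates. *)
Definition lfun_topology (R : realType) (H : vectType R) :=
  initial_topology (@lfmx R H).

Definition ipnorm (R : realType) (H : vectType R) (ip : {dot H for idfun})
    (v : H) : R :=
  Num.sqrt (ip v v).

Definition opnorm (R : realType) (H : vectType R) (ip : {dot H for idfun})
    (A : 'End(H)) : R :=
  sup [set ipnorm ip (A v) | v in [set v | ipnorm ip v <= 1]].

Definition self_adjoint (R : realType) (H : vectType R)
    (ip : {dot H for idfun}) (A : 'End(H)) : Prop :=
  forall u v, ip (A u) v = ip u (A v).

Definition density_operator (R : realType) (H : vectType R)
    (ip : {dot H for idfun}) (Q : 'End(H)) : Prop :=
  [/\ self_adjoint ip Q, forall v, 0 <= ip (Q v) v & lftrace Q = 1].

Definition uniform_density (R : realType) (H : vectType R) : 'End(H) :=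
  (lftrace (\1%VF : 'End(H)))^-1 *: \1%VF.

(* Spectral functional calculus: f(A) acts as multiplication by f a on the
   a-eigenspace of A. For self-adjoint A the eigenvectors span H, so that
   exactly one operator has this property. *)
Definition lfun_calculus (R : realType) (H : vectType R) (f : R -> R)
    (A : 'End(H)) : 'End(H) :=
  xget 0 [set B : 'End(H) |
    forall (a : R) (v : H), A v = a *: v -> B v = f a *: v].

(* As ln 0 = 0, X log X vanishes on the kernel of a positive semidefinite X,
   which is the convention 0 log 0 = 0. The formula is meant for Y positive
   definite; the value +oo that occurs for other Y is not represented. *)
Definition relative_entropy (R : realType) (H : vectType R)
    (X Y : 'End(H)) : R :=
  lftrace (X \o (lfun_calculus (@ln R) X - lfun_calculus (@ln R) Y))%VF.

Definition max_opnorm (R : realType) (H : vectType R) (ip : {dot H for idfun})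
    (T : set 'End(H)) : R :=
  sup [set opnorm ip A | A in T].

Definition trace_support (R : realType) (H : vectType R) (T : set 'End(H))
    (A : 'End(H)) : R :=
  sup [set lftrace (B \o A)%VF | B in T].

(* 'End(H) is not canonically a ring (H may be 0), so p.[F] is written out. *)
Definition lfun_horner (R : realType) (H : vectType R) (p : {poly R})
    (F : 'End(H)) : 'End(H) :=
  \sum_(i < size p) p`_i *: iter i (comp_lfun F) \1%VF.

(* Main.v *)
Require Import Defs.
From HB Require Import structures.
From mathcomp Require Import all_boot all_order all_algebra.
From mathcomp Require Import all_classical all_reals all_analysis.
From mathcomp Require Import complex ring lra.

Set Implicit Arguments.
Unset Strict Implicit.
Unset Printing Implicit Defensive.

Import Order.TTheory GRing.Theory Num.Theory.
Import numFieldNormedType.Exports.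

Local Open Scope classical_set_scope.
Local Open Scope ring_scope.

(* Maximum entropy, carried out with polynomials instead of the exponential.
   Let P be the Taylor polynomial of degree m of exp(lam x / 2) and let G be the
   antiderivative with G' = lam P^2 and G(0) = 1; both P^2 and G have the
   coefficients of exp(lam x) up to degree m and smaller nonnegative ones
   beyond, hence approximate exp(lam x) on the spectra of the elements of T.
   Let F minimise exp(- lam Tr(F Q)) Tr G(F) over the compact set T. As the
   derivative of Tr G at F in the direction D is lam Tr(D P(F)^2), the first
   order condition at F bounds Tr(B (Q - X)) for B in T, where
   X = P(F)^2 / Tr P(F)^2, by Tr(F (Q - X)) up to the approximation error.
   Since lam F is almost log X up to a scalar, Klein's inequality and the
   maximality of the entropy of the uniform density give
   lam Tr(F (Q - X)) <= S(Q || U) + error. It remains to take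
   lam = 4 (1 + S(Q || U)) / eps and m of the order of lam Delta(T); if
   2 Delta(T) <= eps, a constant polynomial suffices. *)

(** * Polynomial approximation of the exponential *)

(** For j > 0, (e |x|)^j / j! is a single term of the series of exp(e |x|), so |x|^j / j! <= e^-j
    exp(e |x|). The geometric tail of e^-j beyond m is at most e^-m because e >= 2. *)
Lemma exp_coeff_tail (R : realType) (x : R) (m N : nat) :
  \sum_(m.+1 <= j < N) exp_coeff `|x| j <= expR (expR 1 * `|x| - m%:R).
Proof.
set e := expR 1; have e2 : 2 <= e.
  by apply: le_trans (expR_ge1Dx 1); rewrite -[2]/(1 + 1).
have term j : (0 < j)%N -> exp_coeff `|x| j <= expR (e * `|x|) * e ^- j.
  case: j => // j _; rewrite -ler_pdivrMr ?invr_gt0 ?exprn_gt0 ?expR_gt0//.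
  have ex0 : 0 <= e * `|x| by rewrite mulr_ge0 ?expR_ge0.
  have := expR_ge1Dxn j ex0; rewrite invrK exprMn exp_coeffE /=.
  by apply: le_trans; rewrite mulrC mulrA mulrAC lerDr.
have geo k : \sum_(m.+1 <= j < m.+1 + k) e ^- j <= e ^- m - e ^- (m + k).
  elim: k => [|k IH]; first by rewrite !addn0 big_geq// subrr.
  rewrite addnS big_nat_recr ?leq_addr//=; apply: le_trans (lerD IH (lexx _)) _.
  rewrite addSn addnS exprS invfM.
  set u := e ^- (m + k)%N; have u0 : 0 <= u by rewrite invr_ge0 exprn_ge0 ?expR_ge0.
  have : e^-1 <= 2^-1 by rewrite lef_pV2 ?posrE ?expR_gt0.
  nra.
have [Nm|mN] := leqP N m.+1; first by rewrite big_geq// expR_ge0.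
rewrite expRD expRN -[m%:R]mulr1 expRM_natl -/e.
rewrite big_nat; apply: (@le_trans _ _ (\sum_(m.+1 <= j < N) expR (e * `|x|) * e ^- j)).
  by rewrite [leRHS]big_nat; apply: ler_sum => j /andP[mj _]; apply: term; apply: leq_trans mj.
rewrite -mulr_sumr ler_wpM2l ?expR_ge0// -(subnKC (ltnW mN)).
by apply: le_trans (geo _) _; rewrite gerBl invr_ge0 exprn_ge0 ?expR_ge0.
Qed.

Definition exp_like (R : realType) (m : nat) (f : {poly R}) :=
  forall j, 0 <= f`_j <= j`!%:R^-1 /\ ((j <= m)%N -> f`_j = j`!%:R^-1).

(** The coefficients of f and of the exponential series agree up to degree m and differ by at most
    1/j! beyond, so the difference with any long enough partial sum obeys the tail bound, which
    passes to the limit. *)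
Lemma exp_like_approx (R : realType) (m : nat) (f : {poly R}) (x : R) :
  exp_like m f -> `|f.[x] - expR x| <= expR (expR 1 * `|x| - m%:R).
Proof.
move=> fP.
have cvgS : series (exp_coeff x) @ \oo --> expR x by exact: is_cvg_series_exp_coeff.
have : (fun N => `|f.[x] - series (exp_coeff x) N|) @ \oo --> `|f.[x] - expR x|.
  by apply: cvg_norm; apply: cvgB => //; exact: cvg_cst.
move=> cv; rewrite -(cvg_lim _ cv)//; apply: limr_le; first by apply/cvg_ex; eexists; exact: cv.
exists (maxn (size f) m.+1) => // N /= ; rewrite geq_max => /andP[fN mN].
rewrite (horner_coef_wide x fN) /series /= big_mkord -sumrB.
apply: le_trans (ler_norm_sum _ _ _) _.
apply: le_trans (exp_coeff_tail x m N).
rewrite -(big_mkord xpredT (fun j => `|f`_j * x ^+ j - exp_coeff x j|)).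
rewrite (big_cat_nat (leq0n m.+1) mN)/= big_nat big1 ?add0r => [|j]; last first.
  by move=> /= jm; rewrite exp_coeffE (fP j).2 ?subrr ?normr0//.
apply: ler_sum => j _; rewrite exp_coeffE /= exp_coeffE /= -mulrBl normrM normrX.
rewrite ler_wpM2r ?exprn_ge0// distrC ger0_norm ?subr_ge0; have [/andP[]//] := fP j.
by move=> ? ? _; rewrite gerBl.
Qed.

(** The exact relation between g' and q^2 is the point: it makes the derivative of Tr g a trace
    against a perfect square, which two unrelated approximations of the exponential would not
    give. *)
Lemma exp_like_poly (R : realType) (m : nat) :
  exists q g : {poly R},
    [/\ size q = m.+1, g^`() = q ^+ 2, exp_like m (q ^+ 2) & exp_like m g].
Proof.
pose a j : R := (2 ^+ j * j`!%:R)^-1.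
have a0 j : 0 < a j by rewrite invr_gt0 mulr_gt0 ?exprn_gt0// ltr0n fact_gt0.
pose q : {poly R} := \poly_(j < m.+1) a j.
(* Coefficientwise form of exp(x/2)^2 = exp(x), that is, the binomial theorem for (1 + 1)^j. *)
have aS j : \sum_(i < j.+1) a i * a (j - i)%N = j`!%:R^-1.
  have -> : j`!%:R^-1 = j`!%:R^-1 * 2 ^- j * \sum_(i < j.+1) 'C(j, i)%:R :> R.
    have -> : \sum_(i < j.+1) 'C(j, i)%:R = 2 ^+ j :> R.
      rewrite -natr_sum -natrX (expnDn 1 1 j : (2 ^ j = _)%N); congr _%:R.
      by apply: eq_bigr => i _; rewrite !exp1n !muln1.
    by rewrite mulfVK// expf_neq0.
  rewrite mulr_sumr; apply: eq_bigr => i _.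
  have ij : (i <= j)%N by rewrite -ltnS.
  have -> : 2 ^+ j = 2 ^+ i * 2 ^+ (j - i) :> R by rewrite -exprD subnKC.
  rewrite -(bin_fact ij) /a !natrM.
  have := fact_gt0 i; have := fact_gt0 (j - i); have := ij; rewrite -bin_gt0.
  rewrite -!(ltr0n R) => /lt0r_neq0 h1 /lt0r_neq0 h2 /lt0r_neq0 h3.
  have h4 k : 2 ^+ k != 0 :> R by rewrite expf_neq0.
  by field; rewrite ?h1 ?h2 ?h3 ?h4.
(* Truncation only removes nonnegative terms from the convolution, and none of them when j <= m. *)
have q2 : exp_like m (q ^+ 2).
  move=> j; rewrite expr2 coefM; split.
    rewrite -aS; apply/andP; split.
      by apply: sumr_ge0 => i _; rewrite !coef_poly mulr_ge0//; case: ifP => // _; exact: ltW.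
    apply: ler_sum => i _; rewrite !coef_poly.
    by do 2?[case: ifP => _]; rewrite ?(mulr0, mul0r)//; apply: mulr_ge0; exact: ltW.
  move=> jm; rewrite -aS; apply: eq_bigr => i _; rewrite !coef_poly !ltnS.
  have ij : (i <= j)%N by rewrite -ltnS.
  by rewrite (leq_trans ij jm) (leq_trans (leq_subr _ _) jm).
pose g : {poly R} := \poly_(j < (size (q ^+ 2)).+1)
  (if j is i.+1 then (q ^+ 2)`_i / j%:R else 1).
have gE j : g`_j = if j is i.+1 then (q ^+ 2)`_i / j%:R else 1.
  rewrite coef_poly; case: j => // i; rewrite ltnS; case: ltnP => // h.
  by rewrite nth_default// mul0r.
exists q, g; split => //.
- by rewrite size_poly_eq// lt0r_neq0.
- by apply/polyP => j; rewrite coef_deriv gE -[LHS]mulr_natr mulfVK ?pnatr_eq0.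
- case=> [|j]; rewrite gE; first by rewrite fact0 invr1 ler01 lexx.
  have [/andP[h1 h2] h3] := q2 j; rewrite factS natrM invfM; split.
    by rewrite divr_ge0//= [leRHS]mulrC ler_wpM2r.
  by move=> jm; rewrite h3 1?mulrC// ltnW.
Qed.

(** * Spectral theorem *)

Section InnerProduct.
Variables (R : realType) (H : vectType R) (ip : {dot H for idfun}).
Implicit Types (u v w : H) (A B : 'End(H)).

Lemma ipC u v : ip u v = ip v u.
Proof. by rewrite (hermC ip) expr0 mul1r. Qed.

Lemma ipDr u v w : ip u (v + w) = ip u v + ip u w.
Proof. by rewrite linearD. Qed.

Lemma ipZr a u v : ip u (a *: v) = a * ip u v.
Proof. by rewrite linearZ. Qed.

Lemma ipBr u v w : ip u (v - w) = ip u v - ip u w.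
Proof. by rewrite linearB. Qed.

Lemma ip0r u : ip u 0 = 0.
Proof. by rewrite linear0. Qed.

Lemma ip_sumr (I : Type) (r : seq I) (P : pred I) (F : I -> H) u :
  ip u (\sum_(i <- r | P i) F i) = \sum_(i <- r | P i) ip u (F i).
Proof. by rewrite linear_sum. Qed.

Lemma ipDl u v w : ip (u + v) w = ip u w + ip v w.
Proof. by rewrite ipC ipDr !(ipC w). Qed.

Lemma ipZl a u v : ip (a *: u) v = a * ip u v.
Proof. by rewrite ipC ipZr ipC. Qed.

Lemma ipBl u v w : ip (u - v) w = ip u w - ip v w.
Proof. by rewrite ipC ipBr !(ipC w). Qed.

Lemma ip0l u : ip 0 u = 0.
Proof. by rewrite ipC ip0r. Qed.

Lemma ip_suml (I : Type) (r : seq I) (P : pred I) (F : I -> H) u :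
  ip (\sum_(i <- r | P i) F i) u = \sum_(i <- r | P i) ip (F i) u.
Proof. by rewrite ipC ip_sumr; under eq_bigr do rewrite ipC. Qed.

Lemma ip_gt0 u : u != 0 -> 0 < ip u u.
Proof. exact: neq0_dnorm_gt0. Qed.

Lemma ip_ge0 u : 0 <= ip u u.
Proof. by have [->|/ip_gt0/ltW//] := eqVneq u 0; rewrite ip0l. Qed.

End InnerProduct.

(** Over the algebraically closed field [R[i]] the characteristic polynomial has a root a + ib; u
    and w are the real and imaginary parts of an eigenvector for it. *)
Lemma mx_complex_eigenvector (R : rcfType) n (M : 'M[R]_n) : (0 < n)%N ->
  exists (u w : 'rV[R]_n) (a b : R),
    [/\ (u != 0) || (w != 0), u *m M = a *: u - b *: w
      & w *m M = b *: u + a *: w].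
Proof.
move=> n0; pose MC : 'M[R[i]]_n := map_mx (real_complex R) M.
have /closed_rootP[z] : size (char_poly MC) != 1.
  by rewrite size_char_poly eqSS -lt0n.
rewrite -eigenvalue_root_char => /eigenvalueP[v vM v0].
have vE j : v 0 j = (complex.Re (v 0 j) +i* complex.Im (v 0 j))%C by case: (v 0 j).
exists (\row_j complex.Re (v 0 j)), (\row_j complex.Im (v 0 j)), (complex.Re z), (complex.Im z).
have key j : \sum_k ((complex.Re (v 0 k) * M k j)%R +i* (complex.Im (v 0 k) * M k j)%R)%C
    = z * v 0 j.
  have /matrixP/(_ 0 j) := vM; rewrite !mxE => <-.
  apply: eq_bigr => k _; rewrite mxE {3}(vE k).
  by apply/eqP; rewrite eq_complex /= !mulr0 subr0 add0r !eqxx.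
have sumE (f g : 'I_n -> R) : \sum_k (f k +i* g k)%C = ((\sum_k f k)%R +i* (\sum_k g k)%R)%C.
  elim/big_rec3: _ => // k x y t _ ->.
  by apply/eqP; rewrite eq_complex /= !eqxx.
split.
- apply: contraNT v0; rewrite negb_or !negbK => /andP[/eqP/matrixP uE /eqP/matrixP wE].
  apply/eqP/matrixP => i j; rewrite (ord1 i) !mxE.
  have := uE 0 j; have := wE 0 j; rewrite !mxE => h1 h2.
  by rewrite vE h1 h2.
- apply/matrixP => i j; rewrite (ord1 i) !mxE; have := key j; rewrite sumE (vE j).
  by case: z {vM key} => za zb [<- _]; apply: eq_bigr => k _; rewrite mxE.
- apply/matrixP => i j; rewrite (ord1 i) !mxE; have := key j; rewrite sumE (vE j).
  case: z {vM key} => za zb [_]; rewrite addrC => <-; apply: eq_bigr => k _; by rewrite mxE.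
Qed.

Section Spectral.
Variables (R : realType) (H : vectType R) (ip : {dot H for idfun}).
Implicit Types (u v w : H) (A B : 'End(H)).

(** The restriction of A to W has a complex eigenvector u + iw with eigenvalue a + ic. Comparing
    <Au, w> with <u, Aw> gives c (|u|^2 + |w|^2) = 0, so the eigenvalue is real and whichever of u,
    w is nonzero is an eigenvector. *)
Lemma self_adjoint_eigenvector A (W : {vspace H}) :
  self_adjoint ip A -> (forall v, v \in W -> A v \in W) -> W != 0%VS ->
  exists v a, [/\ v \in W, v != 0 & A v = a *: v].
Proof.
move=> sA AW W0.
pose B : 'End(subvs_of W) :=
  (linfun (vsproj W) \o A \o linfun (vsval : subvs_of W -> H))%VF.
have BE x : vsval (B x) = A (vsval x).
  by rewrite !comp_lfunE !lfunE /= vsprojK// AW// subvsP.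
pose b := vbasis {:subvs_of W}.
have bP : basis_of {:subvs_of W} b := vbasisP _.
have : (0 < \dim {:subvs_of W})%N.
  by rewrite dimvf /dim /= lt0n dimv_eq0.
move=> /(mx_complex_eigenvector (passmx.mxof b b B)) [x [y [a [c [xy0 xB yB]]]]].
pose u := vsval (passmx.vecof b x); pose w := vsval (passmx.vecof b y).
have vl k l p q : vsval (passmx.vecof b (k *: p + l *: q)) =
    k *: vsval (passmx.vecof b p) + l *: vsval (passmx.vecof b q).
  rewrite /passmx.vecof !linear_sum -big_split /=; apply: eq_bigr => i _.
  by rewrite !mxE scalerDl !scalerA.
have Au : A u = a *: u - c *: w.
  by rewrite -BE (passmx.hom_vecof b bP) xB -!scaleNr vl.
have Aw : A w = c *: u + a *: w.
  by rewrite -BE (passmx.hom_vecof b bP) yB vl.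
have uw : 0 < ip u u + ip w w.
  have vs0 z : (vsval (passmx.vecof b z) == 0) = (z == 0).
    by rewrite -(passmx.vecof_eq0 bP) -(inj_eq val_inj).
  case/orP: xy0 => [x0|y0].
    by rewrite ltr_pwDl ?ip_ge0// ip_gt0// vs0.
  by rewrite ltr_wpDl ?ip_ge0// ip_gt0// vs0.
have c0 : c = 0.
  have := sA u w; rewrite Au Aw ipBl ipDr !ipZl !ipZr => h.
  apply: (mulIf (lt0r_neq0 uw)); rewrite mul0r mulrDr.
  by move/eqP: h; rewrite eq_sym -subr_eq0 => /eqP <-; ring.
have [u0|u0] := eqVneq u 0.
  have w0 : w != 0 by apply: contraTneq uw => ->; rewrite u0 !ip0l addr0 ltxx.
  exists w, a; split=> //; first exact: subvsP.
  by rewrite Aw c0 scale0r add0r.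
exists u, a; split=> //; first exact: subvsP.
by rewrite Au c0 scale0r subr0.
Qed.

(** Completeness is expressed by the expansion formula, so no dimension count is involved; d is
    recovered as the trace of the identity. *)
Definition orthobasis d (e : 'I_d -> H) :=
  (forall i j, ip (e i) (e j) = (i == j)%:R) /\
  (forall v, v = \sum_i ip v (e i) *: e i).

(** Induction on a bound for the dimension: a unit eigenvector u in W is split off, and
    self-adjointness keeps its orthogonal complement in W, cut out by the kernel of <u, .>,
    invariant under A. *)
Lemma self_adjoint_eigenbasis_sub A N (W : {vspace H}) :
  self_adjoint ip A -> (\dim W <= N)%N -> (forall v, v \in W -> A v \in W) ->
  exists d (e : 'I_d -> H) (a : 'I_d -> R),
    [/\ forall i, e i \in W, forall i, A (e i) = a i *: e i,
        forall i j, ip (e i) (e j) = (i == j)%:R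
      & forall v, v \in W -> v = \sum_i ip v (e i) *: e i].
Proof.
move=> sA; elim: N W => [|N IH] W dimW AW.
  exists 0%N, (fun=> 0), (fun=> 0); split; try by case.
  move: dimW; rewrite leqn0 dimv_eq0 => /eqP -> v.
  by rewrite memv0 big_ord0 => /eqP.
have [W0|W0] := eqVneq W 0%VS.
  by apply: IH => //; rewrite W0 dimv0.
have [x [a [xW x0 Ax]]] := self_adjoint_eigenvector sA AW W0.
pose r := Num.sqrt (ip x x); have r0 : 0 < r by rewrite sqrtr_gt0 ip_gt0.
pose u := r^-1 *: x.
have uW : u \in W by rewrite memvZ.
have Au : A u = a *: u by rewrite linearZ /= Ax !scalerA mulrC.
have uu : ip u u = 1.
  rewrite ipZl ipZr mulrA -[ip x x]sqr_sqrtr ?ip_ge0// -/r.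
  by have := lt0r_neq0 r0 => ?; field.
pose f : 'Hom(H, R^o) := linfun (ip u : H -> R^o).
have fE v : f v = ip u v by rewrite lfunE.
pose W' := (W :&: lker f)%VS.
have W'P v : (v \in W') = (v \in W) && (ip u v == 0).
  by rewrite memv_cap memv_ker fE.
have [||d [e [b [eW eA eON eC]]]] := IH W'.
- rewrite -ltnS; apply: leq_trans dimW.
  rewrite (ltn_leqif (dimv_leqif_sup (capvSl _ _))).
  apply/subvP => /(_ u uW); rewrite W'P uW uu oner_eq0//.
- move=> v; rewrite !W'P => /andP[vW /eqP uv]; rewrite AW//=.
  by rewrite -sA Au ipZl uv mulr0.
have ue i : ip u (e i) = 0.
  by have := eW i; rewrite W'P => /andP[_ /eqP].
pose e' (i : 'I_d.+1) := oapp e u (unlift ord0 i).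
pose b' (i : 'I_d.+1) := oapp b a (unlift ord0 i).
exists d.+1, e', b'; split.
- move=> i; rewrite /e'; case: unliftP => [j _|_] //=.
  by have := eW j; rewrite W'P => /andP[].
- by move=> i; rewrite /e' /b'; case: unliftP => [j _|_] /=.
- move=> i j; rewrite /e'; case: unliftP => [i' ->|->]; case: unliftP => [j' ->|->] /=.
  + by rewrite eON (inj_eq lift_inj).
  + by rewrite ipC ue.
  + by rewrite ue.
  + by rewrite uu.
move=> v vW; rewrite big_ord_recl /e' unlift_none /=.
have : v - ip v u *: u \in W'.
  by rewrite W'P memvB ?memvZ//= ipBr ipZr uu mulr1 ipC subrr.
move/eC => h; rewrite -[LHS](subrK (ip v u *: u)) addrC h; congr (_ + _).
apply: eq_bigr => i _; rewrite liftK /=.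
by rewrite ipBl ipZl ue mulr0 subr0.
Qed.

Lemma self_adjoint_eigenbasis A : self_adjoint ip A ->
  exists d (e : 'I_d -> H) (a : 'I_d -> R),
    orthobasis e /\ forall i, A (e i) = a i *: e i.
Proof.
move=> sA; have [|//|d [e [a [_ eA eON eC]]]] :=
  @self_adjoint_eigenbasis_sub A (\dim {:H}) fullv sA.
- by [].
- by move=> v _; rewrite memvf.
by exists d, e, a; split=> //; split=> // v; apply: eC; rewrite memvf.
Qed.

Lemma orthobasis_parseval d (e : 'I_d -> H) u v : orthobasis e ->
  ip u v = \sum_i ip u (e i) * ip v (e i).
Proof.
by move=> [_ eC]; rewrite {1}(eC v) ip_sumr; apply: eq_bigr => i _; rewrite ipZr mulrC.
Qed.

Lemma lftraceE A :
  lftrace A = \sum_i coord (vbasis {:H}) i (A (vbasis {:H})`_i).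
Proof.
apply: eq_bigr => i _.
by rewrite /lfmx /passmx.mxof !mxE /= passmx.vecof_delta.
Qed.
End Spectral.

(** * Trace, entropy and operator norm *)

Section Trace.
Variables (R : realType) (H : vectType R) (ip : {dot H for idfun}).
Implicit Types (u v w : H) (A B : 'End(H)).

Lemma lftraceD A B : lftrace (A + B) = lftrace A + lftrace B.
Proof.
by rewrite !lftraceE -big_split; apply: eq_bigr => i _; rewrite add_lfunE linearD.
Qed.

Lemma lftraceZ (c : R) A : lftrace (c *: A) = c * lftrace A.
Proof.
by rewrite !lftraceE mulr_sumr; apply: eq_bigr => i _; rewrite scale_lfunE linearZ.
Qed.

Lemma lftraceB A B : lftrace (A - B) = lftrace A - lftrace B.
Proof. by rewrite lftraceD -scaleN1r lftraceZ mulN1r. Qed.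

Lemma lftrace_sum (I : finType) (F : I -> 'End(H)) :
  lftrace (\sum_i F i) = \sum_i lftrace (F i).
Proof.
apply: (big_morph (@lftrace R H) lftraceD).
by have := lftraceZ 0 0; rewrite scale0r mul0r.
Qed.

(** Expanding the reference basis b in e on one side, and A e_j in b on the other, turns both traces
    into the same double sum. *)
Lemma lftrace_orthobasis d (e : 'I_d -> H) A : orthobasis ip e ->
  lftrace A = \sum_i ip (A (e i)) (e i).
Proof.
move=> [_ eC]; rewrite lftraceE; set b := vbasis _.
transitivity (\sum_(i < \dim {:H}) \sum_(j < d) ip (b`_i) (e j) * coord b i (A (e j))).
  apply: eq_bigr => i _; rewrite {1}(eC b`_i) !linear_sum.
  by apply: eq_bigr => j _; rewrite !linearZ.
rewrite exchange_big; apply: eq_bigr => j _ /=.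
rewrite [in RHS](coord_vbasis (memvf (A (e j)))) ip_suml.
by apply: eq_bigr => i _; rewrite ipZl mulrC.
Qed.

Lemma lftrace_comp_eigen d (e : 'I_d -> H) (b : 'I_d -> R) A B :
  orthobasis ip e -> (forall i, B (e i) = b i *: e i) ->
  lftrace (A \o B)%VF = \sum_i b i * ip (A (e i)) (e i).
Proof.
move=> eO eB; rewrite (lftrace_orthobasis _ eO); apply: eq_bigr => i _.
by rewrite comp_lfunE eB linearZ ipZl.
Qed.

Lemma lftrace_eigen d (e : 'I_d -> H) (b : 'I_d -> R) B :
  orthobasis ip e -> (forall i, B (e i) = b i *: e i) ->
  lftrace B = \sum_i b i.
Proof.
move=> eO eB; rewrite (lftrace_orthobasis _ eO); apply: eq_bigr => i _.
by rewrite eB ipZl eO.1 eqxx mulr1.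
Qed.

Lemma lftrace_id d (e : 'I_d -> H) : orthobasis ip e ->
  lftrace (\1%VF : 'End(H)) = d%:R.
Proof.
move=> eO; rewrite (lftrace_eigen (b := fun=> 1) eO).
  by rewrite sumr_const card_ord.
by move=> i; rewrite id_lfunE scale1r.
Qed.

(** The defining property has to be satisfiable, as [xget] returns 0 otherwise. The operator
    multiplying e_i by f(a_i) satisfies it, because an eigenvector for b has no component along e_i
    unless a_i = b. *)
Lemma lfun_calculus_eigen (f : R -> R) A v a : self_adjoint ip A ->
  A v = a *: v -> lfun_calculus f A v = f a *: v.
Proof.
move=> sA; rewrite /lfun_calculus; move: a v.
apply: (@xgetPex _ 0 [set B : 'End(H) |
    forall (a : R) (v : H), A v = a *: v -> B v = f a *: v]).
have [d [e [a [eO eA]]]] := self_adjoint_eigenbasis sA.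
pose g v : H := \sum_i (f (a i) * ip v (e i)) *: e i.
have gl : linear g.
  move=> k u v; rewrite /g scaler_sumr -big_split; apply: eq_bigr => i _ /=.
  by rewrite ipDl ipZl scalerA -scalerDl; congr (_ *: _); ring.
pose G : {linear H -> H} := HB.pack g (GRing.isLinear.Build _ _ _ _ g gl).
exists (linfun G) => b v Av; rewrite [LHS](lfunE G v) /g.
rewrite [in RHS](eO.2 v) scaler_sumr; apply: eq_bigr => i _.
rewrite scalerA; congr (_ *: _).
have : (a i - b) * ip v (e i) = 0.
  by rewrite mulrBl -[a i * _]ipZr -eA -sA Av ipZl subrr.
by move=> /eqP; rewrite mulf_eq0 subr_eq0 => /orP[/eqP->//|/eqP->]; rewrite !mulr0.
Qed.

Lemma relative_entropy_uniform d (e : 'I_d -> H) (q : 'I_d -> R) Q :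
  orthobasis ip e -> self_adjoint ip Q -> (forall i, Q (e i) = q i *: e i) ->
  (0 < d)%N ->
  relative_entropy Q (uniform_density H) =
    \sum_i q i * ln (q i) + (\sum_i q i) * ln d%:R.
Proof.
move=> eO sQ eQ d0; rewrite /relative_entropy.
set L := (_ - _)%R.
have eL i : L (e i) = (ln (q i) + ln d%:R) *: e i.
  rewrite /L add_lfunE opp_lfunE (lfun_calculus_eigen _ sQ (eQ i)).
  rewrite (@lfun_calculus_eigen _ _ _ d%:R^-1).
  - by rewrite -scalerBl lnV ?posrE ?ltr0n// opprK.
  - move=> u v; rewrite /uniform_density !scale_lfunE !id_lfunE ipZl ipZr//.
  - by rewrite /uniform_density (lftrace_id eO) scale_lfunE id_lfunE.
rewrite (lftrace_comp_eigen _ eO eL) mulr_suml -big_split; apply: eq_bigr => i _ /=.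
by rewrite eQ ipZl eO.1 eqxx mulr1 mulrC mulrDr.
Qed.

(** For q > 0 this is ln(1 + y) <= y at y = x / q - 1; for q = 0 the left side vanishes. *)
Lemma mul_ln_sub_le (q x : R) : 0 <= q -> 0 < x -> q * ln x - q * ln q <= x - q.
Proof.
rewrite le_eqVlt => /predU1P[<-|q0] x0; first by rewrite !mul0r !subr0 ltW.
have xq : 0 < x / q by rewrite divr_gt0.
have : ln (1 + (x / q - 1)) <= x / q - 1 by apply: le_ln1Dx; lra.
rewrite addrCA subrr addr0 ln_div ?posrE// => h.
rewrite -mulrBr; have : q * (ln x - ln q) <= q * (x / q - 1) by rewrite ler_pM2l.
by move=> /le_trans; apply; rewrite mulrBr mulr1 mulrC divfK ?gt_eqF.
Qed.

(* Klein's inequality: [|<f_i, e_j>|^2] is doubly stochastic, which reduces it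
   to [q ln x - q ln q <= x - q]. *)
Lemma klein d d' (e : 'I_d -> H) (q : 'I_d -> R) (f : 'I_d' -> H)
    (x : 'I_d' -> R) Q :
  orthobasis ip e -> orthobasis ip f -> self_adjoint ip Q ->
  (forall i, Q (e i) = q i *: e i) -> (forall i, 0 <= q i) ->
  (forall i, 0 < x i) -> \sum_i x i = \sum_i q i ->
  \sum_i ip (Q (f i)) (f i) * ln (x i) <= \sum_j q j * ln (q j).
Proof.
move=> eO fO sQ eQ q0 x0 xq.
pose w i j := ip (f i) (e j) ^+ 2.
have wi i : \sum_j w i j = 1.
  transitivity (ip (f i) (f i)); last by rewrite fO.1 eqxx.
  by rewrite (orthobasis_parseval _ _ eO); apply: eq_bigr => j _; rewrite /w expr2.
have wj j : \sum_i w i j = 1.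
  transitivity (ip (e j) (e j)); last by rewrite eO.1 eqxx.
  by rewrite (orthobasis_parseval _ _ fO); apply: eq_bigr => i _; rewrite /w expr2 ipC.
rewrite -subr_le0.
have -> : \sum_i ip (Q (f i)) (f i) * ln (x i)
    = \sum_i \sum_j w i j * (q j * ln (x i)).
  apply: eq_bigr => i _; rewrite (orthobasis_parseval _ _ eO) mulr_suml.
  by apply: eq_bigr => j _; rewrite sQ eQ ipZr /w; ring.
have -> : \sum_j q j * ln (q j) = \sum_i \sum_j w i j * (q j * ln (q j)).
  by rewrite exchange_big; apply: eq_bigr => j _ /=; rewrite -mulr_suml wj mul1r.
rewrite -sumrB; under eq_bigr do rewrite -sumrB.
apply: (@le_trans _ _ (\sum_i \sum_j w i j * (x i - q j))).
  apply: ler_sum => i _; apply: ler_sum => j _; rewrite -mulrBr.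
  by rewrite ler_wpM2l ?sqr_ge0// mul_ln_sub_le.
under eq_bigr do under eq_bigr do rewrite mulrBr.
under eq_bigr do rewrite sumrB; rewrite sumrB [X in _ - X]exchange_big /=.
under eq_bigr do rewrite -mulr_suml wi mul1r.
under [X in _ - X]eq_bigr do rewrite -mulr_suml wj mul1r.
by rewrite xq subrr.
Qed.

(** Tr(A^2) is the sum of the squared eigenvalues and so dominates each of them. Being continuous in
    A, it later shows that the suprema in [opnorm] and, on a compact set, in [max_opnorm] are taken
    over bounded sets. *)
Lemma self_adjoint_norm_le A v : self_adjoint ip A ->
  ip (A v) (A v) <= lftrace (A \o A)%VF * ip v v.
Proof.
move=> sA; have [d [e [a [eO eA]]]] := self_adjoint_eigenbasis sA.
rewrite (@lftrace_eigen _ e (fun i => a i ^+ 2) _ eO); last first.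
  by move=> i; rewrite comp_lfunE !(eA, linearZ) /= eA scalerA.
rewrite !(orthobasis_parseval _ _ eO) mulr_suml; apply: ler_sum => i _.
rewrite sA eA ipZr mulrACA -!expr2 ler_wpM2l ?sqr_ge0//.
by rewrite (bigD1 i)//= -expr2 lerDl sumr_ge0// => j _; rewrite -expr2 sqr_ge0.
Qed.

Lemma ipnorm_le_sqrt_trace A v : self_adjoint ip A -> ipnorm ip v <= 1 ->
  ipnorm ip (A v) <= Num.sqrt (lftrace (A \o A)%VF).
Proof.
move=> sA v1; rewrite ler_wsqrtr//; apply: le_trans (self_adjoint_norm_le _ sA) _.
have t0 : 0 <= lftrace (A \o A)%VF.
  have [d [e [a [eO eA]]]] := self_adjoint_eigenbasis sA.
  rewrite (lftrace_orthobasis _ eO); apply: sumr_ge0 => i _.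
  by rewrite comp_lfunE sA ip_ge0.
rewrite -[leRHS]mulr1 ler_wpM2l//.
by rewrite -[ip v v]sqr_sqrtr ?ip_ge0// expr_le1// sqrtr_ge0.
Qed.

Lemma opnorm_le A : self_adjoint ip A ->
  opnorm ip A <= Num.sqrt (lftrace (A \o A)%VF).
Proof.
move=> sA; apply: ge_sup => [|_ [v v1 <-]]; last exact: ipnorm_le_sqrt_trace.
by exists (ipnorm ip (A 0)), 0 => //=; rewrite /ipnorm ip0l sqrtr0 ler01.
Qed.

Lemma eigenvalue_le_opnorm A v a : self_adjoint ip A -> ip v v = 1 ->
  A v = a *: v -> `|a| <= opnorm ip A.
Proof.
move=> sA v1 Av; have -> : `|a| = ipnorm ip (A v).
  by rewrite /ipnorm Av ipZl ipZr v1 mulr1 -expr2 sqrtr_sqr.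
apply: ub_le_sup; last by exists v => //=; rewrite /ipnorm v1 sqrtr1.
by exists (Num.sqrt (lftrace (A \o A)%VF)) => _ [u u1 <-]; exact: ipnorm_le_sqrt_trace.
Qed.

(** In an eigenbasis of A the trace is the sum of the eigenvalues of A with the nonnegative weights
    <B e_i, e_i>. *)
Lemma lftrace_psd_le A B (D : R) : self_adjoint ip A -> opnorm ip A <= D ->
  (forall v, 0 <= ip (B v) v) -> `|lftrace (A \o B)%VF| <= D * lftrace B.
Proof.
move=> sA AD B0; have [d [e [a [eO eA]]]] := self_adjoint_eigenbasis sA.
rewrite !(lftrace_orthobasis _ eO) mulr_sumr.
apply: le_trans (ler_norm_sum _ _ _) _; apply: ler_sum => i _.
rewrite comp_lfunE sA eA ipZr normrM (ger0_norm (B0 _)) ler_wpM2r//.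
by apply: le_trans AD; apply: eigenvalue_le_opnorm (eA i); rewrite ?eO.1 ?eqxx.
Qed.

End Trace.

(** * First variation of the trace of a polynomial *)

Lemma sum_continuous (R : realType) (X : topologicalType) (I : Type) (r : seq I)
    (f : I -> X -> R) :
  (forall i, continuous (f i)) -> continuous (fun x => \sum_(i <- r) f i x).
Proof.
move=> fc; elim: r => [|i r IH].
  rewrite (_ : (fun x => _) = cst 0); first exact: cst_continuous.
  by apply/funext => x; rewrite big_nil.
rewrite (_ : (fun x => _) = f i \+ (fun x => \sum_(j <- r) f j x)).
  by move=> x; apply: continuousD; [exact: fc|exact: IH].
by apply/funext => x; rewrite big_cons.
Qed.

Section LfunContinuity.
Variables (R : realType) (H : vectType R) (X : topologicalType).
Implicit Types (f g : X -> 'End(H)) (c : X -> R).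

(** Continuity is tested on matrix entries; the parameter space X will be both [lfun_topology H] and
    the real line. *)
Definition lfun_continuous f := forall i j, continuous (fun x => lfmx (f x) i j).

Lemma lfun_continuous_cst A : lfun_continuous (fun=> A).
Proof. by move=> i j x; exact: cvg_cst. Qed.

Lemma lfun_continuousD f g :
  lfun_continuous f -> lfun_continuous g -> lfun_continuous (fun x => f x + g x).
Proof.
move=> fc gc i j; rewrite (_ : (fun x => _) =
  (fun x => lfmx (f x) i j) \+ (fun x => lfmx (g x) i j)).
  by move=> x; apply: continuousD; [exact: fc|exact: gc].
apply/funext => x; rewrite /lfmx /=.
have := passmx.mxof_linear (vbasis {:H}) (vbasis {:H}) 1 (f x) (g x).
by rewrite !scale1r => ->; rewrite mxE.
Qed.

Lemma lfun_continuousZ c f :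
  continuous c -> lfun_continuous f -> lfun_continuous (fun x => c x *: f x).
Proof.
move=> cc fc i j; rewrite (_ : (fun x => _) = c \* (fun x => lfmx (f x) i j)).
  by move=> x; apply: continuousM; [exact: cc|exact: fc].
apply/funext => x; rewrite /lfmx /=.
have := passmx.mxof_linear (vbasis {:H}) (vbasis {:H}) (c x) (f x) 0.
have -> : passmx.mxof (vbasis {:H}) (vbasis {:H}) (0 : 'End(H)) = 0.
  apply/eqP; rewrite passmx.mxof_eq0 ?vbasisP//.
by rewrite !addr0 => ->; rewrite mxE.
Qed.

Lemma lfun_continuous_comp f g :
  lfun_continuous f -> lfun_continuous g ->
  lfun_continuous (fun x => (f x \o g x)%VF).
Proof.
move=> fc gc i j; rewrite (_ : (fun x => _) =
  (fun x => \sum_k lfmx (g x) i k * lfmx (f x) k j)).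
  apply: sum_continuous => k x.
  by apply: (@continuousM _ _ (fun x => lfmx (g x) i k) (fun x => lfmx (f x) k j));
     [exact: gc|exact: fc].
by apply/funext => x; rewrite /lfmx (passmx.mxof_comp _ _ (vbasisP _)) mxE.
Qed.

Lemma lfun_continuous_iter k f :
  lfun_continuous f ->
  lfun_continuous (fun x => iter k (comp_lfun (f x)) \1%VF).
Proof.
move=> fc; elim: k => [|k IH]; first exact: lfun_continuous_cst.
exact: lfun_continuous_comp.
Qed.

Lemma lftrace_continuous f : lfun_continuous f -> continuous (fun x => lftrace (f x)).
Proof. by move=> fc; apply: sum_continuous => i; exact: fc. Qed.

Lemma lfun_continuous_horner (p : {poly R}) f :
  lfun_continuous f -> continuous (fun x => lftrace (lfun_horner p (f x))).
Proof.
move=> fc; rewrite (_ : (fun x => _) =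
  (fun x => \sum_(k < size p) p`_k * lftrace (iter k (comp_lfun (f x)) \1%VF))).
  apply: sum_continuous => k x.
  apply: (@continuousM _ _ (cst p`_k)
    (fun x => lftrace (iter k (comp_lfun (f x)) \1%VF))).
    exact: cst_continuous.
  by apply: lftrace_continuous; exact: lfun_continuous_iter.
apply/funext => x; rewrite /lfun_horner lftrace_sum.
by apply: eq_bigr => k _; rewrite lftraceZ.
Qed.

End LfunContinuity.

Lemma lfun_continuous_id (R : realType) (H : vectType R) :
  @lfun_continuous R H (lfun_topology H) (fun A => A).
Proof.
move=> i j A; apply: (@continuous_comp _ _ _ (@lfmx R H : lfun_topology H -> _)
  (fun M : 'M[R]_(\dim {:H}) => M i j)).
  exact: initial_continuous.
exact: coord_continuous.
Qed.

Section Variation.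
Variables (R : realType) (H : vectType R) (ip : {dot H for idfun}).
Implicit Types (F D Q : 'End(H)).

Lemma iter_comp_eigen F v (a : R) k : F v = a *: v ->
  iter k (comp_lfun F) \1%VF v = a ^+ k *: v.
Proof.
move=> Fv; elim: k => [|k IH] /=; first by rewrite id_lfunE expr0 scale1r.
by rewrite comp_lfunE IH linearZ /= Fv scalerA -exprSr.
Qed.

Lemma lfun_horner_eigen (p : {poly R}) F v (a : R) : F v = a *: v ->
  lfun_horner p F v = p.[a] *: v.
Proof.
move=> Fv; rewrite /lfun_horner sum_lfunE horner_coef scaler_suml.
by apply: eq_bigr => k _; rewrite scale_lfunE (iter_comp_eigen k Fv) scalerA.
Qed.

(* The difference quotient [((F + s D)^k - F^k) / s]. *)
Fixpoint power_diffq F D (s : R) k : 'End(H) :=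
  if k is k'.+1 then
    ((F + s *: D) \o power_diffq F D s k')%VF + (D \o iter k' (comp_lfun F) \1)%VF
  else 0.

(** No division by s occurs, so the quotient is also defined at s = 0, where it is the derivative of
    the k-th power in the direction D. *)
Lemma power_diffqE F D s k : iter k (comp_lfun (F + s *: D)) \1%VF =
  iter k (comp_lfun F) \1%VF + s *: power_diffq F D s k.
Proof.
elim: k => [|k IH] /=; first by rewrite scaler0 addr0.
rewrite IH comp_lfunDr -comp_lfunZr scalerDr comp_lfunDl -comp_lfunZl -addrA.
by congr (_ + _); rewrite addrC.
Qed.

Lemma power_diffq_continuous F D k : @lfun_continuous R H R (fun s => power_diffq F D s k).
Proof.
elim: k => [|k IH] /=; first exact: lfun_continuous_cst.
apply: lfun_continuousD; last exact: lfun_continuous_cst.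
apply: lfun_continuous_comp => //; apply: lfun_continuousD; first exact: lfun_continuous_cst.
by apply: lfun_continuousZ; [move=> s; exact: cvg_id|exact: lfun_continuous_cst].
Qed.

(** At s = 0 the quotient is the sum of the k products F^i D F^(k-1-i). Although F and D need not
    commute, the left powers move to the other argument, and each product contributes a^(k-1) <Dv,
    v>. *)
Lemma power_diffq0_eigen F D k v (a : R) : self_adjoint ip F -> F v = a *: v ->
  ip (power_diffq F D 0 k v) v = (a ^+ k.-1 *+ k) * ip (D v) v.
Proof.
move=> sF Fv; elim: k => [|k IH] /=; first by rewrite zero_lfunE ip0l mulr0n mul0r.
rewrite scale0r addr0 add_lfunE !comp_lfunE (iter_comp_eigen k Fv) linearZ /=.
rewrite ipDl ipZl sF Fv ipZr IH mulrSr.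
rewrite mulrA mulrDl; congr (_ * _ + _).
by case: k {IH} => [|k] /=; rewrite ?mulr0n ?mulr0// mulrnAr -exprS.
Qed.

Lemma horner_deriv_coef (p : {poly R}) (a : R) :
  p^`().[a] = \sum_(k < size p) p`_k * (a ^+ k.-1 *+ k).
Proof.
rewrite -{1}[p]coefK poly_def linear_sum horner_sum; apply: eq_bigr => k _.
by rewrite linearZ /= derivXn hornerZ hornerMn hornerXn.
Qed.

Lemma right_limit_ge (g : R -> R) (c : R) :
  continuous g -> (forall s, 0 < s <= 1 -> c <= g s) -> c <= g 0.
Proof.
move=> gc cg.
have cv : g x @[x --> 0^'+] --> g 0 by apply: cvg_at_right_filter; exact: gc.
rewrite -(cvg_lim _ cv)//; apply: limr_ge; first by apply/cvg_ex; eexists; exact: cv.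
near=> s; apply: cg; apply/andP; split; near: s; first exact: nbhs_right_gt.
exact: nbhs_right_le.
Unshelve. all: by end_near. Qed.

(** Write g0 = Tr G(F), t = Tr(DQ) and Tr G(F + sD) = g0 + s rho(s). Minimality gives g0 exp(s lam
    t) <= g0 + s rho(s), and exp(y) >= 1 + y turns this into g0 lam t <= rho(s). Now let s tend to
    0, where rho is the derivative of the trace. *)
Lemma trace_horner_first_order d (f : 'I_d -> H) (a : 'I_d -> R) F D Q lam
    (G : {poly R}) :
  orthobasis ip f -> self_adjoint ip F -> (forall i, F (f i) = a i *: f i) ->
  0 <= lftrace (lfun_horner G F) ->
  (forall s, 0 < s <= 1 ->
    expR (- (lam * lftrace (F \o Q)%VF)) * lftrace (lfun_horner G F) <=
    expR (- (lam * lftrace ((F + s *: D) \o Q)%VF))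
      * lftrace (lfun_horner G (F + s *: D))) ->
  lftrace (lfun_horner G F) * (lam * lftrace (D \o Q)%VF) <=
  \sum_i G^`().[a i] * ip (D (f i)) (f i).
Proof.
move=> fO sF fF; set g0 := lftrace (lfun_horner G F) => g00 Fmin.
pose rho s := \sum_(k < size G) G`_k * lftrace (power_diffq F D s k).
have rhoc : continuous rho.
  apply: sum_continuous => k s.
  apply: (@continuousM _ _ (cst G`_k) (fun s => lftrace (power_diffq F D s k))).
    exact: cst_continuous.
  by apply: lftrace_continuous; exact: power_diffq_continuous.
have gs s : lftrace (lfun_horner G (F + s *: D)) = g0 + s * rho s.
  rewrite /g0 /lfun_horner !lftrace_sum /rho mulr_sumr -big_split; apply: eq_bigr => k _ /=.
  by rewrite power_diffqE !lftraceZ lftraceD lftraceZ; ring.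
have -> : \sum_i G^`().[a i] * ip (D (f i)) (f i) = rho 0.
  under eq_bigr do rewrite horner_deriv_coef mulr_suml.
  rewrite exchange_big; apply: eq_bigr => k _ /=.
  rewrite (lftrace_orthobasis _ fO) mulr_sumr; apply: eq_bigr => i _.
  by rewrite (power_diffq0_eigen _ _ sF (fF i)) mulrA.
apply: right_limit_ge => // s /andP[s0 s1].
have := Fmin s; rewrite s0 s1 => /(_ isT).
rewrite gs comp_lfunDl lftraceD -comp_lfunZl lftraceZ [lam * (_ + _)]mulrDr opprD expRD -mulrA.
rewrite ler_pM2l ?expR_gt0// expRN mulrC ler_pdivlMr ?expR_gt0// => h.
set t := lftrace (D \o Q)%VF in h *.
have h2 : g0 * (1 + lam * (s * t)) <= g0 + s * rho s.
  by apply: le_trans h; rewrite ler_wpM2l// expR_ge1Dx.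
rewrite -(ler_pM2l s0) -(lerD2l g0); apply: le_trans h2.
by rewrite le_eqVlt; apply/orP; left; apply/eqP; ring.
Qed.

End Variation.

(** * Gibbs states *)

Section Extremal.
Variables (R : realType) (H : vectType R) (ip : {dot H for idfun}).
Implicit Types (A B F Q : 'End(H)) (T : set 'End(H)).

Lemma opnorm_le_max_opnorm T A : compact (T : set (lfun_topology H)) ->
  (forall B, T B -> self_adjoint ip B) -> T A ->
  opnorm ip A <= max_opnorm ip T.
Proof.
move=> Tc Tsa TA.
have trc : continuous (fun B : lfun_topology H => lftrace ((B : 'End(H)) \o B)%VF).
  apply: lftrace_continuous; apply: lfun_continuous_comp; exact: lfun_continuous_id.
have T0 : (T : set (lfun_topology H)) !=set0 by exists A.
have [M _ MP] := compact_EVT_max T0 Tc (continuous_subspaceT trc).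
apply: ub_le_sup; last by exists A.
exists (Num.sqrt (lftrace ((M : 'End(H)) \o M)%VF)) => _ [B TB <-].
apply: le_trans (opnorm_le (Tsa _ TB)) _.
by rewrite ler_wsqrtr// MP// inE.
Qed.

Lemma opnorm_ge0 A : self_adjoint ip A -> 0 <= opnorm ip A.
Proof.
move=> sA; apply: (@le_trans _ _ (ipnorm ip (A 0))); first exact: sqrtr_ge0.
apply: ub_le_sup; last by exists 0 => //=; rewrite /ipnorm ip0l sqrtr0 ler01.
exists (Num.sqrt (lftrace (A \o A)%VF)) => _ [u u1 <-].
exact: (ipnorm_le_sqrt_trace sA).
Qed.

Lemma convex_set_segment T A B (s : R) :
  convex_set (T : set (convex_lmodType 'End(H))) -> T A -> T B ->
  0 < s <= 1 -> T (A + s *: (B - A)).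
Proof.
move=> Tconv TA TB /andP[/ltW s0 s1].
have := Tconv B A (Itv01 s0 s1); rewrite !inE => /(_ TB TA).
have -> : A + s *: (B - A) = s *: B + (1 - s) *: A.
  by rewrite scalerBr scalerBl scale1r addrCA.
by [].
Qed.

Lemma density_eigenbasis Q : density_operator ip Q ->
  exists d (e : 'I_d -> H) (q : 'I_d -> R),
    [/\ (0 < d)%N, orthobasis ip e, forall i, Q (e i) = q i *: e i,
        forall i, 0 <= q i & \sum_i q i = 1].
Proof.
move=> [sQ Qpos Qtr]; have [d [e [q [eO eQ]]]] := self_adjoint_eigenbasis sQ.
exists d, e, q; rewrite -(lftrace_eigen eO eQ); split=> // [|i]; last first.
  by have := Qpos (e i); rewrite eQ ipZl eO.1 eqxx mulr1.
case: d e q eO eQ => // e q eO eQ.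
by move/eqP: Qtr; rewrite (lftrace_eigen eO eQ) big_ord0 eq_sym oner_eq0.
Qed.

(** Klein's inequality against the constant spectrum 1/d. *)
Lemma relative_entropy_uniform_ge0 Q : density_operator ip Q ->
  0 <= relative_entropy Q (uniform_density H).
Proof.
move=> dQ; have [d [e [q [d0 eO eQ q0 q1]]]] := density_eigenbasis dQ.
have [sQ _ Qtr] := dQ.
have dn0 : d%:R != 0 :> R by rewrite pnatr_eq0 -lt0n.
rewrite (relative_entropy_uniform eO sQ eQ d0) q1 mul1r -lerBlDr sub0r.
have -> : - ln d%:R = \sum_i ip (Q (e i)) (e i) * ln (d%:R^-1 : R).
  by rewrite -mulr_suml -(lftrace_orthobasis _ eO) Qtr mul1r lnV// posrE ltr0n.
apply: (klein (x := fun=> d%:R^-1) eO eO sQ eQ q0) => [i|].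
  by rewrite invr_gt0 ltr0n.
by rewrite sumr_const card_ord q1 -(mulr_natr d%:R^-1) mulVf.
Qed.

(** For u = ln x - y, exp(u) lies within de of 1. The upper bound follows from 1 + u <= exp(u), the
    lower one from 1 - u <= exp(-u) <= 1 / (1 - de) <= 1 + 2 de, which uses de <= 1/2. *)
Lemma ln_approx (x y de : R) : 0 <= de -> de <= 2^-1 ->
  `|x - expR y| <= de * expR y -> 0 < x /\ `|ln x - y| <= 2 * de.
Proof.
move=> de0 de2; rewrite ler_distl => /andP[h1 h2].
have E0 := expR_gt0 y.
have x0 : 0 < x by nra.
split=> //; set u := ln x - y.
have xE : x = expR u * expR y by rewrite -expRD subrK lnK.
have u1 : expR u <= 1 + de by rewrite -(ler_pM2r E0) -xE; lra.
have u2 : 1 - de <= expR u by rewrite -(ler_pM2r E0) -xE; lra.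
have := expR_ge1Dx u; have := expR_ge1Dx (- u); rewrite expRN => h3 h4.
have v0 := expR_gt0 u.
have h5 : (expR u)^-1 <= 1 + 2 * de.
  by rewrite -[leLHS]mul1r ler_pdivrMr//; nra.
by rewrite ler_norml; apply/andP; split; lra.
Qed.

(* The maximum entropy principle: [h i] stands for the eigenvalues of the
   unnormalised Gibbs state [exp (lam F)]. *)
Lemma gibbs_gap d (f : 'I_d -> H) (a h : 'I_d -> R) F Q (lam de : R) :
  orthobasis ip f -> self_adjoint ip F -> (forall i, F (f i) = a i *: f i) ->
  density_operator ip Q -> 0 <= de <= 2^-1 ->
  (forall i, `|h i - expR (lam * a i)| <= de * expR (lam * a i)) ->
  lam * (lftrace (F \o Q)%VF - \sum_i h i / (\sum_j h j) * a i) <=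
  relative_entropy Q (uniform_density H) + 4 * de.
Proof.
move=> fO sF fF dQ /andP[de0 de2] hE; have [sQ Qpos Qtr] := dQ.
have [d' [e [q [d0 eO eQ q0 q1]]]] := density_eigenbasis dQ.
have dd : d = d'.
  apply/eqP; rewrite -(eqr_nat R).
  by rewrite -(lftrace_id fO) (lftrace_id eO).
case: d' / dd e q d0 eO eQ q0 q1 => e q d0 eO eQ q0 q1.
have dn0 : 0 < d%:R :> R by rewrite ltr0n.
have h0 i : 0 < h i := (ln_approx de0 de2 (hE i)).1.
have lnh i : `|ln (h i) - lam * a i| <= 2 * de := (ln_approx de0 de2 (hE i)).2.
set Z := \sum_j h j.
have Z0 : 0 < Z.
  by rewrite /Z (bigD1 (Ordinal d0))//= ltr_pwDl// sumr_ge0// => i _; rewrite ltW.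
pose x i := h i / Z.
have x0 i : 0 < x i by rewrite divr_gt0.
have x1 : \sum_i x i = 1 by rewrite -mulr_suml divff// gt_eqF.
have lnx i : ln (h i) = ln (x i) + ln Z by rewrite ln_div ?posrE// subrK.
pose Qf i := ip (Q (f i)) (f i).
have Qf1 : \sum_i Qf i = 1 by rewrite -(lftrace_orthobasis _ fO).
rewrite (relative_entropy_uniform eO sQ eQ d0) q1 mul1r.
have FQ : lftrace (F \o Q)%VF = \sum_i Qf i * a i.
  rewrite (lftrace_orthobasis _ fO); apply: eq_bigr => i _.
  by rewrite comp_lfunE sF fF ipZr mulrC.
(* Klein's inequality for Q against the normalised spectrum x. Replacing lam a_i by ln h_i = ln x_i
   + ln Z costs 2 de; the term ln Z cancels against the one in [hX]. *)
have hQ : lam * lftrace (F \o Q)%VF <= \sum_i q i * ln (q i) + ln Z + 2 * de.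
  have k1 : \sum_i Qf i * ln (x i) <= \sum_i q i * ln (q i).
    by apply: (klein eO fO sQ eQ q0 x0); rewrite x1 q1.
  apply: (@le_trans _ _ (\sum_i Qf i * (ln (x i) + (ln Z + 2 * de)))).
    rewrite FQ mulr_sumr; apply: ler_sum => i _; rewrite mulrCA ler_wpM2l ?Qpos//.
    by have := lnh i; rewrite ler_norml lnx => /andP[+ _]; lra.
  under eq_bigr do rewrite mulrDr.
  by rewrite big_split /= -mulr_suml Qf1 mul1r -addrA lerD2r.
(* The entropy of x is at most ln d. *)
have hX : - ln d%:R + ln Z - 2 * de <= lam * \sum_i x i * a i.
  have k2 : - ln d%:R <= \sum_i x i * ln (x i).
    rewrite -subr_le0.
    have -> : - ln d%:R - \sum_i x i * ln (x i) =
        \sum_i (x i * ln (d%:R^-1) - x i * ln (x i)).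
      by rewrite sumrB -mulr_suml x1 mul1r lnV ?posrE.
    apply: (@le_trans _ _ (\sum_(i < d) (d%:R^-1 - x i))).
      apply: ler_sum => i _; apply: mul_ln_sub_le; last by rewrite invr_gt0.
      exact: ltW.
    by rewrite sumrB sumr_const card_ord x1 -(mulr_natr d%:R^-1) mulVf ?subrr// gt_eqF.
  apply: (@le_trans _ _ (\sum_i x i * (ln (x i) + (ln Z - 2 * de)))).
    under eq_bigr do rewrite mulrDr.
    by rewrite big_split /= -mulr_suml x1 mul1r -addrA lerD2r.
  rewrite mulr_sumr; apply: ler_sum => i _; rewrite [leRHS]mulrCA ler_wpM2l ?(ltW (x0 _))//.
  by have := lnh i; rewrite ler_norml lnx => /andP[_ +]; lra.
rewrite mulrBr; move: hQ hX; rewrite /x; lra.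
Qed.

End Extremal.

(** Two errors add up: the entropy gap at the minimiser F, divided by lam, and the mismatch between
    Tr G(F) and Tr P(F)^2, where G only approximates its own derivative divided by lam. *)
Lemma polynomial_gibbs_step (R : realType) (H : vectType R)
    (ip : {dot H for idfun}) (T : set 'End(H)) (Q : 'End(H)) (m : nat)
    (lam de : R) :
  T !=set0 ->
  compact (T : set (lfun_topology H)) ->
  convex_set (T : set (convex_lmodType 'End(H))) ->
  (forall A, T A -> self_adjoint ip A) ->
  density_operator ip Q ->
  0 < lam -> 0 <= de <= 2^-1 ->
  expR ((expR 1 + 1) * (lam * max_opnorm ip T) - m%:R) <= de ->
  exists (p : {poly R}) (F : 'End(H)),
    [/\ size p = m.+1,
        T F,
        lftrace (lfun_horner p F \o lfun_horner p F)%VF = 1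
      & forall B, T B ->
          lftrace (B \o (Q - (lfun_horner p F \o lfun_horner p F)%VF))%VF <=
          (relative_entropy Q (uniform_density H) + 4 * de) / lam
            + 8 * de * max_opnorm ip T].
Proof.
move=> T0 Tc Tconv Tsa dQ lam0 /[dup] de01 /andP[de0 de2] mde.
set K := max_opnorm ip T.
have TK A : T A -> opnorm ip A <= K by exact: opnorm_le_max_opnorm.
have [q0 [g [sq gq2 q2E gE]]] := exp_like_poly R m.
pose c : {poly R} := lam *: 'X.
pose G := g \Po c; pose P := q0 \Po c.
have cE y : c.[y] = lam * y by rewrite hornerZ hornerX.
have approx f y : exp_like m f -> `|y| <= K ->
    `|f.[lam * y] - expR (lam * y)| <= de * expR (lam * y).
  move=> fE yK; apply: le_trans (exp_like_approx _ fE) _.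
  (* The absolute error is exp(e lam |y| - m); making it relative to exp(lam y) >= exp(- lam |y|)
     costs another lam K, whence the factor e + 1. *)
  apply: (@le_trans _ _ (expR ((expR 1 + 1) * (lam * K) - m%:R + lam * y))).
    rewrite ler_expR normrM (gtr0_norm lam0).
    have e0 := expR_gt0 (1 : R).
    have : lam * `|y| <= lam * K by rewrite ler_pM2l.
    have : - (lam * `|y|) <= lam * y.
      by rewrite -mulrN ler_pM2l// lerNl -normrN ler_norm.
    nra.
  by rewrite expRD ler_wpM2r ?expR_ge0.
(* Its logarithm would be the dual functional of entropy maximisation; the product form is
   continuous everywhere, whatever the sign of the trace. *)
pose Psi (A : lfun_topology H) : R :=
  expR (- (lam * lftrace ((A : 'End(H)) \o Q)%VF)) * lftrace (lfun_horner G A).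
have Psic : continuous Psi.
  move=> A; apply: (@continuousM _ _
    (fun A : lfun_topology H => expR (- (lam * lftrace ((A : 'End(H)) \o Q)%VF)))
    (fun A : lfun_topology H => lftrace (lfun_horner G A))); last first.
    by apply: lfun_continuous_horner; exact: lfun_continuous_id.
  apply: continuous_comp; last exact: continuous_expR.
  apply: continuousN; apply: continuousM; first exact: cst_continuous.
  apply: lftrace_continuous; apply: lfun_continuous_comp.
    exact: lfun_continuous_id.
  exact: lfun_continuous_cst.
have T0' : (T : set (lfun_topology H)) !=set0 by [].
have [F] := compact_EVT_min T0' Tc (continuous_subspaceT Psic).
rewrite inE => TF Fmin; have sF := Tsa _ TF.
have [d [f [a [fO fF]]]] := self_adjoint_eigenbasis sF.
have aK i : `|a i| <= K.
  by apply: le_trans (TK _ TF); apply: eigenvalue_le_opnorm (fF i); rewrite ?fO.1 ?eqxx.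
pose h i := (q0 ^+ 2).[lam * a i].
have hE i : `|h i - expR (lam * a i)| <= de * expR (lam * a i) by exact: approx.
have h0 i : 0 < h i := (ln_approx de0 de2 (hE i)).1.
have hP i : h i = P.[a i] ^+ 2 by rewrite /h /P horner_comp cE horner_exp.
have gi i : `|G.[a i] - expR (lam * a i)| <= de * expR (lam * a i).
  by rewrite /G horner_comp cE; exact: approx.
set E := \sum_i expR (lam * a i).
set Z := \sum_i h i.
have d0 : (0 < d)%N.
  have [d' [e [_ [d'0 eO _ _ _]]]] := density_eigenbasis dQ.
  by rewrite -(ltr0n R) -(lftrace_id fO) (lftrace_id eO) ltr0n.
have E0 : 0 < E.
  rewrite /E (bigD1 (Ordinal d0))//=; apply: ltr_pwDl; first exact: expR_gt0.
  by apply: sumr_ge0 => i _; exact: expR_ge0.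
have sumE (u : 'I_d -> R) :
    (forall i, `|u i - expR (lam * a i)| <= de * expR (lam * a i)) ->
    `|\sum_i u i - E| <= de * E.
  move=> uE; rewrite /E mulr_sumr -sumrB.
  by apply: le_trans (ler_norm_sum _ _ _) _; apply: ler_sum => i _.
have trG : lftrace (lfun_horner G F) = \sum_i G.[a i].
  by apply: (lftrace_eigen fO) => i; exact: lfun_horner_eigen.
set g0 := lftrace (lfun_horner G F) in trG *.
have /ler_normlP[Zl Zu] := sumE _ hE; rewrite -/Z in Zl Zu.
have /ler_normlP[gl gu] := sumE _ gi; rewrite -trG in gl gu.
have g00 : 0 < g0 by nra.
have Z0 : 0 < Z by nra.
(* First order condition along the segment from F to B. The chain rule for G gives G' = lam P^2, and
   this factor lam cancels the one in the exponent. *)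
have foc B : T B ->
    lftrace ((B - F) \o Q)%VF * g0 <= \sum_i h i * ip ((B - F) (f i)) (f i).
  move=> TB; rewrite -(ler_pM2l lam0) mulrA mulrC.
  apply: le_trans (trace_horner_first_order fO sF fF (ltW g00) _) _.
    move=> s s01; have := Fmin (F + s *: (B - F)); rewrite inE; apply.
    exact: convex_set_segment.
  rewrite mulr_sumr; apply: ler_sum => i _.
  rewrite deriv_comp gq2 hornerM horner_comp cE derivZ derivX hornerZ hornerC mulr1.
  by rewrite [_ * lam]mulrC -mulrA.
pose p := (Num.sqrt Z)^-1 *: P; exists p, F.
have sZ : Num.sqrt Z != 0 by rewrite gt_eqF// sqrtr_gt0.
set X := (lfun_horner p F \o lfun_horner p F)%VF.
have fX i : X (f i) = (h i / Z) *: f i.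
  rewrite /X comp_lfunE !(lfun_horner_eigen _ (fF i)) linearZ /=.
  rewrite (lfun_horner_eigen _ (fF i)) scalerA; congr (_ *: _).
  by rewrite /p hornerZ hP -[X in _ = _ / X](sqr_sqrtr (ltW Z0)); field.
have trX : lftrace X = 1.
  by rewrite (lftrace_eigen fO fX) -mulr_suml divff// gt_eqF.
have Xpos v : 0 <= ip (X v) v.
  rewrite (orthobasis_parseval _ _ fO); apply: sumr_ge0 => i _.
  have -> : ip (X v) (f i) = h i / Z * ip v (f i).
    rewrite [in X v](fO.2 v) linear_sum ip_suml (bigD1 i)//= big1 => [|j ji].
      by rewrite linearZ /= ipZl fX ipZl fO.1 eqxx addr0 mulr1 mulrC.
    by rewrite linearZ /= ipZl fX ipZl fO.1 (negPf ji) !mulr0.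
  rewrite -[leRHS]mulrA -expr2; apply: mulr_ge0; last exact: sqr_ge0.
  by apply: divr_ge0; exact: ltW.
split=> //.
  by rewrite /p size_scale ?invr_eq0// size_comp_poly2 ?sq// size_scale ?size_polyX ?gt_eqF.
move=> B TB; rewrite comp_lfunDr comp_lfunNr lftraceB.
have trBX A : lftrace (A \o X)%VF = \sum_i h i / Z * ip (A (f i)) (f i).
  exact: lftrace_comp_eigen.
have BXK A : T A -> `|lftrace (A \o X)%VF| <= K.
  by move=> TA; rewrite -[K]mulr1 -trX; apply: lftrace_psd_le; [exact: Tsa|exact: TK|].
have gap : lam * (lftrace (F \o Q)%VF - lftrace (F \o X)%VF) <=
    relative_entropy Q (uniform_density H) + 4 * de.
  apply: le_trans (gibbs_gap fO sF fF dQ de01 hE).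
  rewrite ler_pM2l// lerB// trBX; apply: ler_sum => i _.
  by rewrite fF ipZl fO.1 eqxx mulr1.
have {}foc : (lftrace (B \o Q)%VF - lftrace (F \o Q)%VF) * g0 <=
    Z * (lftrace (B \o X)%VF - lftrace (F \o X)%VF).
  have := foc B TB; rewrite comp_lfunDl comp_lfunNl lftraceB => /le_trans; apply.
  rewrite !trBX -sumrB mulr_sumr; apply: ler_sum => i _.
  rewrite add_lfunE opp_lfunE ipBl -mulrBr mulrA [Z * _]mulrC mulfVK ?gt_eqF//.
rewrite -ler_pdivlMl// mulrC in gap.
have := BXK _ TB; have := BXK _ TF; rewrite !ler_norml.
move: foc gap.
set bq := lftrace (B \o Q)%VF; set fq := lftrace (F \o Q)%VF.
set bx := lftrace (B \o X)%VF; set fx := lftrace (F \o X)%VF.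
move=> foc gap /andP[fx1 fx2] /andP[bx1 bx2].
(* Both Z and g0 are within de E of E, and E <= 2 g0 because de <= 1/2. *)
have ZG : `|Z - g0| <= 4 * de * g0 by apply/ler_normlP; split; nra.
have : (bq - fq - (bx - fx)) * g0 <= (8 * de * K) * g0.
  have : (Z - g0) * (bx - fx) <= 4 * de * g0 * (2 * K).
    apply: le_trans (ler_norm _) _; rewrite normrM ler_pM//.
    by apply/ler_normlP; split; lra.
  nra.
rewrite ler_pM2r//; lra.
Qed.

Theorem theorem4p5 (R : realType) :
  exists C : R, 0 < C /\
  forall eps : R, 0 < eps < 2^-1 ->
  forall (H : vectType R) (ip : {dot H for idfun})
         (T : set 'End(H)) (Q : 'End(H)),
    T !=set0 ->
    compact (T : set (lfun_topology H)) ->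
    convex_set (T : set (convex_lmodType 'End(H))) ->
    (forall A, T A -> self_adjoint ip A) ->
    density_operator ip Q ->
    exists (k : nat) (p : {poly R}) (F : 'End(H)),
      [/\ k%:R <= C * (1 + relative_entropy Q (uniform_density H))
                    * (max_opnorm ip T / eps),
          size p = k.+1,
          T F,
          lftrace (lfun_horner p F \o lfun_horner p F)%VF = 1
        & trace_support T
            (Q - (lfun_horner p F \o lfun_horner p F)%VF) <= eps].
Proof.
set e := expR 1 : R; have e0 : 0 < e := expR_gt0 _.
(* With x = Delta(T) / eps > 1/2, the degree is at most 4 (e + 1) (1 + S) x + 16 x + 1, and 1 <= 2
   x; hence 4 (e + 1) + 16 + 2. *)
exists (4 * e + 22); split; first by lra.
move=> eps /andP[eps0 _] H ip T Q T0 Tc Tconv Tsa dQ.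
set K := max_opnorm ip T; set S := relative_entropy Q (uniform_density H).
have S0 : 0 <= S := relative_entropy_uniform_ge0 dQ.
have TK A : T A -> opnorm ip A <= K by exact: opnorm_le_max_opnorm.
have supP X : (forall B, T B -> lftrace (B \o X)%VF <= eps) ->
    trace_support T X <= eps.
  move=> TX; apply: ge_sup => [|_ [B TB <-]]; last exact: TX.
  by have [A TA] := T0; exists (lftrace (A \o X)%VF), A.
have K0 : 0 <= K.
  by have [A TA] := T0; apply: le_trans (TK _ TA); exact: opnorm_ge0 (Tsa _ TA).
(* If 2 K <= eps, any two density operators are eps-close when tested on T, so the uniform density,
   the square of a constant, will do. Otherwise K / eps > 1/2 absorbs additive constants in the
   degree. *)
have [K2|K2] := leP (2 * K) eps.
  have [F TF] := T0; have sF := Tsa _ TF.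
  have [d [f [_ [d0 fO _ _ _]]]] := density_eigenbasis dQ.
  pose r : R := Num.sqrt (d%:R^-1).
  have r0 : 0 < r by rewrite sqrtr_gt0 invr_gt0 ltr0n.
  have rr : r * r = d%:R^-1 by rewrite -expr2 sqr_sqrtr// invr_ge0.
  exists 0%N, r%:P, F.
  have hE : lfun_horner r%:P F = r *: \1%VF.
    rewrite /lfun_horner size_polyC gt_eqF//= big_ord1 coefC eqxx.
    by [].
  have XE : (lfun_horner r%:P F \o lfun_horner r%:P F)%VF = d%:R^-1 *: \1%VF.
    by rewrite hE -comp_lfunZl comp_lfun1l scalerA rr.
  have dn0 : d%:R != 0 :> R by rewrite pnatr_eq0 -lt0n.
  have trX : lftrace (d%:R^-1 *: \1%VF : 'End(H)) = 1.
    by rewrite lftraceZ (lftrace_id fO) mulVf.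
  split=> //; rewrite ?XE ?trX//.
  - by apply: mulr_ge0; [apply: mulr_ge0; lra|rewrite divr_ge0 ?(ltW eps0)].
  - by rewrite size_polyC gt_eqF.
  apply: supP => B TB; rewrite comp_lfunDr comp_lfunNr lftraceB.
  have [sQ Qpos Qtr] := dQ.
  have := lftrace_psd_le (Tsa _ TB) (TK _ TB) Qpos.
  have : forall v, 0 <= ip ((d%:R^-1 *: \1%VF : 'End(H)) v) v.
    by move=> v; rewrite scale_lfunE id_lfunE ipZl mulr_ge0 ?invr_ge0 ?ip_ge0.
  move=> /(lftrace_psd_le (Tsa _ TB) (TK _ TB)).
  rewrite trX Qtr mulr1 !ler_norml => /andP[? ?] /andP[? ?]; lra.
set x := K / eps; have xK : x * eps = K by rewrite /x mulfVK// gt_eqF.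
have x2 : 1 < 2 * x by rewrite -(ltr_pM2r eps0) -mulrA xK mul1r.
(* Chosen so that the entropy term (S + 4 de) / lam is at most eps / 2. *)
pose lam := 4 * (1 + S) / eps.
have lam0 : 0 < lam by rewrite divr_gt0//; lra.
have lamK : lam * K = 4 * (1 + S) * x by rewrite /lam /x; ring.
(* The summand 16 x = 1 / de pays for the accuracy: exp(y) >= 1 + y makes exp(m - (e + 1) lam K) at
   least 16 x as soon as m > t. *)
pose t := (e + 1) * (lam * K) + 16 * x.
have t0 : 0 <= t.
  apply: addr_ge0; last by lra.
  by apply: mulr_ge0; [lra|apply: mulr_ge0 => //; exact: ltW].
pose m := (Num.truncn t).+1.
have mt : t < m%:R := truncnS_gt t.
have tm : m%:R <= t + 1 by rewrite /m -natr1 lerD2r truncn_le.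
(* Equal to eps / (16 K), so that the mismatch error 8 de K is exactly eps / 2. *)
pose de := (16 * x)^-1.
have x0 : 0 < 16 * x by lra.
have de8 : de <= 8^-1 by rewrite lef_pV2 ?posrE//; lra.
have de0 : 0 < de by rewrite invr_gt0.
have mde : expR ((expR 1 + 1) * (lam * max_opnorm ip T) - m%:R) <= de.
  have -> : (expR 1 + 1) * (lam * max_opnorm ip T) - m%:R = - (m%:R - (e + 1) * (lam * K)).
    by rewrite opprB.
  rewrite expRN lef_pV2 ?posrE ?expR_gt0//; apply: le_trans (expR_ge1Dx _).
  by move: mt; rewrite /t; lra.
have de01 : 0 <= de <= 2^-1 by rewrite ltW//=; lra.
have [p [F [sp TF trp HB]]] :=
  polynomial_gibbs_step T0 Tc Tconv Tsa dQ lam0 de01 mde.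
exists m, p, F; split=> //.
  apply: le_trans tm _; rewrite /t lamK.
  have : x <= (1 + S) * x by rewrite ler_peMl; lra.
  lra.
apply: supP => B TB; apply: le_trans (HB B TB) _.
have deK : 8 * de * K = eps / 2.
  by rewrite -xK /de; have := lt0r_neq0 x0 => ?; field; rewrite gt_eqF//; lra.
rewrite deK -/S.
have : (S + 4 * de) / lam <= eps / 2.
  rewrite ler_pdivrMr// /lam.
  have -> : eps / 2 * (4 * (1 + S) / eps) = 2 * (1 + S) by field; rewrite gt_eqF.
  lra.
lra.
Qed.
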